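(* Let $n\ge 3$ and $K\subseteq\{2,\ldots,n-1\}$. Then the generalised Fishburn domain $F_K$ is a directly connected domain of maximal width.
   Context: $[n]=\{1,\ldots,n\}$. The generalised Fishburn domain $F_K$ is the set of all linear orders $v$ on $[n]$ such that for all $1\le i<j<k\le n$: if $j\in K$ then $j$ is not ranked last by $v$ among $\{i,j,k\}$, and if $j\notin K$ then $j$ is not ranked first by $v$ among $\{i,j,k\}$. A domain of linear orders has maximal width if it contains two completely reversed orders (for $F_K$: $12\ldots n$ and $n\ldots 21$). The permutohedron of order $n$ is the graph whose vertices are the linear orders on $[n]$, two orders being adjacent if they differ by swapping two alternatives in neighbouring positions. A domain is directly connected if any two of its orders are joined by a shortest path (geodesic) in the permutohedron all of whose vertices belong to the domain. *)

(* Defs.v *)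
From mathcomp Require Import all_boot all_fingroup.

Set Implicit Arguments.
Unset Strict Implicit.
Unset Printing Implicit Defensive.

(* The ordinal a : 'I_n stands for the alternative a.+1 of [n] = {1, ..., n}.
   A linear order on [n] is given by its rank function v : 'S_n: v a is the
   (0-based) position of the alternative a, position 0 being the top, so that
   a is preferred to b exactly when v a < v b. *)

Definition ranked_first n (v : 'S_n) (j : 'I_n) (A : {set 'I_n}) : bool :=
  (j \in A) && [forall x in A, v j <= v x].

Definition ranked_last n (v : 'S_n) (j : 'I_n) (A : {set 'I_n}) : bool :=
  (j \in A) && [forall x in A, v x <= v j].

Definition fishburn n (K : {set 'I_n}) : {set 'S_n} :=
  [set v : 'S_n | [forall i : 'I_n, forall j : 'I_n, forall k : 'I_n,
     (i < j < k) ==>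
       if j \in K then ~~ ranked_last v j [set i; j; k]
       else ~~ ranked_first v j [set i; j; k]]].

Definition completely_reversed n (v w : 'S_n) : Prop :=
  forall a b : 'I_n, (w a < w b) = (v b < v a).

Definition maximal_width n (D : {set 'S_n}) : Prop :=
  exists v w : 'S_n, [/\ v \in D, w \in D & completely_reversed v w].

(* Since (s * t) x = t (s x), the order tperm a b * v is v with the
   alternatives a and b exchanged. *)
Definition permutohedron n : rel 'S_n :=
  [rel v w : 'S_n | [exists a : 'I_n, exists b : 'I_n,
     (nat_of_ord (v b) == (v a).+1) && (w == (tperm a b * v)%g)]].

(* The vertices of the path are x :: p, and size p is its length. *)
Definition geodesic (T : eqType) (e : rel T) (x y : T) (p : seq T) : Prop :=
  [/\ path e x p, last x p = y &
      forall q : seq T, path e x q -> last x q = y -> size p <= size q].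

Definition directly_connected n (D : {set 'S_n}) : Prop :=
  forall v w : 'S_n, v \in D -> w \in D ->
    exists p : seq 'S_n,
      geodesic (@permutohedron n) v w p /\ {subset v :: p <= D}.

(* Main.v *)
Require Import Defs.
From mathcomp Require Import all_boot all_fingroup.
From mathcomp Require Import all_order all_algebra.
From mathcomp Require Import zify ring lra.

(* An order v is determined by its inversions, the pairs a < b with b
   preferred to a. For i < j < k the never-conditions say that, on the pairs
   ij, ik, jk, the inversions form an initial segment of this list if j is in K
   and a final segment otherwise. Place the alternatives in convex position from
   left to right, those of K on the lower arc and the others on the upper arc;
   then the slopes of the chords ij, ik, jk are increasing in the first case and
   decreasing in the second, so inversions can be removed one at a time: among the
   inversions of v that are not inversions of w, the one of greatest slope is a
   pair of neighbours in v whose swap stays in the domain. If every inversion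
   of v is one of w, exchange their roles. This yields a path of length the number
   of pairs on which v and w disagree, and no path is shorter. *)

Set Implicit Arguments.
Unset Strict Implicit.
Unset Printing Implicit Defensive.

(** * Discordant pairs and distance in the permutohedron *)

Section Discordance.
Variable n : nat.
Implicit Types (u v w : 'S_n) (a b x y : 'I_n).

Lemma perm_ltNge v a b : a != b -> (v a < v b) = ~~ (v b < v a).
Proof.
move=> ab; have : (v a : nat) != v b by rewrite val_eqE (inj_eq perm_inj).
lia.
Qed.

Lemma swapE v a b x : (tperm a b * v)%g x = v (tperm a b x).
Proof. exact: permM. Qed.

(** Neighbours [a] and [b] lie on the same side of any third alternative, so only their mutual
    comparison changes. *)
Lemma swap_lt v a b x y : v b = (v a).+1 :> nat ->
  (x, y) != (a, b) -> (x, y) != (b, a) ->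
  ((tperm a b * v)%g x < (tperm a b * v)%g y) = (v x < v y).
Proof.
move=> vab; rewrite !swapE !xpair_eqE.
have inj z t : z != t -> (v z : nat) != v t.
  by rewrite val_eqE (inj_eq perm_inj).
have [->|xa] := eqVneq x a.
  rewrite tpermL; have [->|ya] := eqVneq y a; first by rewrite tpermL !ltnn.
  have [->|yb] := eqVneq y b => //= _ _.
  rewrite tpermD 1?eq_sym //; have := inj _ _ ya; have := inj _ _ yb; lia.
have [->|xb] := eqVneq x b.
  rewrite tpermR; have [->|yb] := eqVneq y b; first by rewrite tpermR !ltnn.
  have [->|ya] := eqVneq y a => //=.
  rewrite tpermD 1?eq_sym // => _ _; have := inj _ _ ya; have := inj _ _ yb; lia.
move=> _ _; rewrite (@tpermD _ a b x) 1?eq_sym //.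
have := inj _ _ xa; have := inj _ _ xb.
by case: tpermP => [->|->|//]; lia.
Qed.

Lemma permutohedronP v w : reflect
  (exists a b, v b = (v a).+1 :> nat /\ w = (tperm a b * v)%g)
  (permutohedron v w).
Proof.
apply: (iffP existsP) => [[a /existsP[b /andP[/eqP vab /eqP ->]]]|[a [b [vab ->]]]].
  by exists a, b.
by exists a; apply/existsP; exists b; rewrite vab !eqxx.
Qed.

Lemma permutohedron_sym v w : permutohedron v w = permutohedron w v.
Proof.
wlog suff: v w / permutohedron v w -> permutohedron w v.
  by move=> H; apply/idP/idP; exact: H.
case/permutohedronP=> a [b [vab ->]]; apply/permutohedronP; exists b, a.
by rewrite !swapE tpermL tpermR vab tpermC mulgA tperm2 mul1g.
Qed.

(** Each pair on which the orders disagree occurs once, oriented as in [v]; the cardinality is the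
    Kendall tau distance. *)
Definition discordant v w : {set 'I_n * 'I_n} :=
  [set p | (v p.1 < v p.2) && (w p.2 < w p.1)].

Lemma card_discordantC v w : #|discordant v w| = #|discordant w v|.
Proof.
have sw_inj : injective (fun p : 'I_n * 'I_n => (p.2, p.1)) by move=> [? ?] [? ?] [-> ->].
rewrite -(card_preimset _ sw_inj); apply: eq_card => -[a b].
by rewrite !inE /= andbC.
Qed.

Lemma card_perm_lt v x : #|[set y | v y < v x]| = v x.
Proof.
have -> : [set y | v y < v x] = v @^-1: [set i : 'I_n | i < v x].
  by apply/setP => y; rewrite !inE.
rewrite card_preimset; last exact: perm_inj.
rewrite cardsE -sum1_card -(big_ord_widen _ (fun=> 1)) ?sum1_card ?card_ord //.
exact: ltnW.
Qed.

(** The rank of an alternative is the number of alternatives above it, so the comparisons determine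
    the order. *)
Lemma discordant_eq0 v w : discordant v w = set0 -> v = w.
Proof.
move=> /setP D0; have le_vw x y : v x < v y -> w x < w y.
  have [->|nxy] := eqVneq x y; first by rewrite !ltnn.
  by move=> vxy; have := D0 (x, y); rewrite !inE vxy /= (perm_ltNge w nxy) => ->.
apply/permP => x; apply: val_inj; rewrite /= -(card_perm_lt v) -(card_perm_lt w).
apply: eq_card => y; rewrite !inE; apply/idP/idP => [/le_vw //|].
have [->|nxy] := eqVneq x y; first by rewrite !ltnn.
rewrite [v y < _]perm_ltNge 1?eq_sym //; apply: contraTN => /le_vw; lia.
Qed.

Lemma card_discordant_swap v w a b : v b = (v a).+1 :> nat ->
  #|discordant v w| <= #|discordant (tperm a b * v) w|.+1.
Proof.
move=> vab; rewrite (cardsD1 (a, b)) -add1n leq_add ?leq_b1 //.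
apply/subset_leq_card/subsetP => -[x y]; rewrite in_setD1 !in_set /= => /and3P[nab vxy ->].
rewrite swap_lt // ?vxy //; apply: contraTneq vxy => -[-> ->]; lia.
Qed.

(** The pair [(a, b)] disappears, and [(b, a)], the only new comparison, agrees with [w]. *)
Lemma card_discordant_swap_lt v w a b : v b = (v a).+1 :> nat -> w b < w a ->
  #|discordant (tperm a b * v) w| < #|discordant v w|.
Proof.
move=> vab wba; have abD : (a, b) \in discordant v w by rewrite inE /= vab ltnSn.
rewrite (cardsD1 (a, b) (discordant v w)) abD ltnS.
apply/subset_leq_card/subsetP => -[x y]; rewrite in_setD1 !in_set /= => /andP[vxy wyx].
have nab : (x, y) != (a, b).
  by apply: contraTneq vxy => -[-> ->]; rewrite !swapE tpermL tpermR; lia.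
have nba : (x, y) != (b, a) by apply: contraTneq wyx => -[-> ->]; lia.
by rewrite nab wyx andbT -(swap_lt vab nab nba).
Qed.

(** An edge lowers the count by at most one, and the count is zero at the end of the path. *)
Lemma card_discordant_path v w p : path (@permutohedron n) v p -> last v p = w ->
  #|discordant v w| <= size p.
Proof.
elim: p v => [|u p IHp] v /=.
  move=> _ <-; rewrite leqn0 cards_eq0; apply/eqP/setP => -[x y].
  by rewrite !inE /=; lia.
case/andP=> /permutohedronP[a [b [vab ->]]] pth lst.
by rewrite (leq_trans (card_discordant_swap w vab)) // ltnS IHp.
Qed.

End Discordance.

(** * Slopes of chords between points in convex position *)

Section Chords.
Import Order.TTheory GRing.Theory Num.Theory.
Local Open Scope ring_scope.

Lemma mediant_lt (R : realFieldType) (p q r s : R) : 0 < q -> 0 < s ->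
  p / q < r / s -> p / q < (p + r) / (q + s) < r / s.
Proof.
move=> q0 s0; have qs0 : 0 < q + s by rewrite addr_gt0.
rewrite !ltr_pdivrMr // mulrAC ltr_pdivlMr // => lt_pr.
rewrite mulrAC ltr_pdivlMr // mulrAC ltr_pdivlMr //.
by apply/andP; split; lra.
Qed.

Variables (n : nat) (K : {set 'I_n}).
Implicit Types i j k : 'I_n.

(* The points (i, height i) lie on the arcs y = -x(n - x) and y = x(n - x). *)
Definition height i : rat :=
  let y := i%:R * (n%:R - i%:R) in if i \in K then - y else y.

Definition slope i j : rat := (height j - height i) / (j%:R - i%:R).

Lemma height_bound i : - (i%:R * (n%:R - i%:R)) <= height i <= i%:R * (n%:R - i%:R).
Proof.
have : 0 <= i%:R * (n%:R - i%:R) :> rat.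
  by rewrite mulr_ge0 // subr_ge0 ler_nat ltnW.
by rewrite /height; case: ifP => _ h; apply/andP; split; lra.
Qed.

Lemma slope_between i j k : (i < j < k)%N ->
  (slope i j < slope j k -> slope i j < slope i k < slope j k) /\
  (slope j k < slope i j -> slope j k < slope i k < slope i j).
Proof.
case/andP=> ij jk.
have ij0 : 0 < j%:R - i%:R :> rat by rewrite subr_gt0 ltr_nat.
have jk0 : 0 < k%:R - j%:R :> rat by rewrite subr_gt0 ltr_nat.
(* The slope of the long chord is the mediant of the other two. *)
have -> : slope i k = (height j - height i + (height k - height j)) /
    (j%:R - i%:R + (k%:R - j%:R)).
  by congr (_ / _); ring.
split; first exact: mediant_lt.
by rewrite (addrC (height j - _)) (addrC (j%:R - _)); apply: mediant_lt.
Qed.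

Lemma slope_K i j k : (i < j < k)%N -> j \in K -> slope i j < slope i k < slope j k.
Proof.
move=> ijk jK; apply: (slope_between ijk).1; case/andP: ijk => ij jk.
have ij0 : 0 < j%:R - i%:R :> rat by rewrite subr_gt0 ltr_nat.
have jk0 : 0 < k%:R - j%:R :> rat by rewrite subr_gt0 ltr_nat.
have /andP[hi _] := height_bound i; have /andP[hk _] := height_bound k.
have hj : height j = - (j%:R * (n%:R - j%:R)) by rewrite /height jK.
(* The chord of the lower parabola over [i] and [j] has slope [i + j - n]. Point [j] is on this
   parabola and [i], [k] are on or above it, which bounds the slope of [ij] from above and that of
   [jk] from below. *)
apply: (@le_lt_trans _ _ (i%:R + j%:R - n%:R)).
  by rewrite ler_pdivrMr // hj; lra.
apply: (@lt_le_trans _ _ (j%:R + k%:R - n%:R)); first by lra.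
by rewrite ler_pdivlMr // hj; lra.
Qed.

Lemma slope_notinK i j k : (i < j < k)%N -> j \notin K -> slope j k < slope i k < slope i j.
Proof.
move=> ijk jK; apply: (slope_between ijk).2; case/andP: ijk => ij jk.
have ij0 : 0 < j%:R - i%:R :> rat by rewrite subr_gt0 ltr_nat.
have jk0 : 0 < k%:R - j%:R :> rat by rewrite subr_gt0 ltr_nat.
have /andP[_ hi] := height_bound i; have /andP[_ hk] := height_bound k.
have hj : height j = j%:R * (n%:R - j%:R) by rewrite /height (negPf jK).
(* Likewise with the upper parabola, whose chord over [j] and [k] has slope [n - j - k]. *)
apply: (@le_lt_trans _ _ (n%:R - j%:R - k%:R)).
  by rewrite ler_pdivrMr // hj; lra.
apply: (@lt_le_trans _ _ (n%:R - i%:R - j%:R)); first by lra.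
by rewrite ler_pdivlMr // hj; lra.
Qed.

End Chords.

(** * Removing inversions inside the Fishburn domain *)

Section Fishburn.
Variables (n : nat) (K : {set 'I_n}).
Implicit Types (v w : 'S_n) (a b c i j k x y : 'I_n).

Lemma fishburnP v : reflect
  (forall i j k, i < j < k ->
     if j \in K then (v j < v i) || (v j < v k) else (v i < v j) || (v k < v j))
  (v \in fishburn K).
Proof.
have lastE i j k : ranked_last v j [set i; j; k] = (v i <= v j) && (v k <= v j).
  rewrite /ranked_last !inE eqxx orbT /=; apply/forall_inP/andP => [H|[ij kj] x].
    by split; apply: H; rewrite !inE eqxx ?orbT.
  by rewrite !inE => /orP[/orP[]|] /eqP ->.
have firstE i j k : ranked_first v j [set i; j; k] = (v j <= v i) && (v j <= v k).
  rewrite /ranked_first !inE eqxx orbT /=; apply/forall_inP/andP => [H|[ij kj] x].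
    by split; apply: H; rewrite !inE eqxx ?orbT.
  by rewrite !inE => /orP[/orP[]|] /eqP ->.
rewrite inE; apply: (iffP forallP) => [H i j k ijk|H i].
  have /forallP/(_ j)/forallP/(_ k)/implyP/(_ ijk) := H i.
  by rewrite lastE firstE !negb_and -!ltnNge.
apply/forallP => j; apply/forallP => k; apply/implyP => /H.
by rewrite lastE firstE !negb_and -!ltnNge.
Qed.

Lemma fishburn_inv_K v i j k : v \in fishburn K -> i < j < k -> j \in K ->
  (v k < v j -> v k < v i) /\ (v k < v i -> v j < v i).
Proof. by move=> /fishburnP H ijk jK; have := H _ _ _ ijk; rewrite jK; lia. Qed.

Lemma fishburn_inv_notinK v i j k : v \in fishburn K -> i < j < k -> j \notin K ->
  (v j < v i -> v k < v i) /\ (v k < v i -> v k < v j).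
Proof.
move=> /fishburnP H ijk /negPf jK; have := H _ _ _ ijk; rewrite jK.
lia.
Qed.

(* Abstracts what is used of an inversion of greatest slope in v but not in w. *)
Definition extremal v a b :=
  [/\ a < b, v b < v a,
      forall c, a < b < c -> b \in K -> v a <= v c,
      forall c, a < c < b -> v c < v a -> v c <= v b &
      forall c, c < a < b -> a \notin K -> v c <= v b].

Lemma exists_extremal v w i j : v \in fishburn K -> w \in fishburn K ->
  i < j -> v j < v i -> w i < w j -> exists a b, extremal v a b /\ w a < w b.
Proof.
move=> vF wF ij vji wij.
pose P (p : 'I_n * 'I_n) := [&& p.1 < p.2, v p.2 < v p.1 & w p.1 < w p.2].
have Pij : P (i, j) by apply/and3P.
case: (Order.TotalTheory.arg_maxP (fun p => slope K p.1 p.2) Pij) => -[a b].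
case/and3P=> /= ab vba wab maxab; exists a, b; split => //.
(* By maximality, every inversion of [v] of slope greater than that of [ab] is one of [w]. *)
have {}maxab x y : x < y -> (slope K a b < slope K x y)%R -> v y < v x -> w y < w x.
  move=> xy lt_ab vyx; have nxy : y != x by apply: contraTneq xy => ->; lia.
  rewrite (perm_ltNge w nxy); apply: contraTN lt_ab => wxy.
  by rewrite -Order.TotalTheory.leNgt (maxab (x, y)) // /P /= xy vyx.
(* If a clause failed, [v] would have an inversion of greater slope among [a], [b], [c]. It would be
   one of [w] too, and the never-condition for [w] would make [ab] an inversion of [w]. *)
split=> // c.
- move=> abc bK; have [ab_ac _] := andP (slope_K abc bK).
  have := maxab a c _ ab_ac; have := fishburn_inv_K wF abc bK; lia.
- move=> acb vca; have [cK|cK] := boolP (c \in K).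
    have /andP[_ ab_cb] := slope_K acb cK.
    have := maxab c b _ ab_cb; have := fishburn_inv_K wF acb cK; lia.
  have /andP[_ ab_ac] := slope_notinK acb cK.
  have := maxab a c _ ab_ac; have := fishburn_inv_notinK wF acb cK; lia.
- move=> cab aK; have /andP[ab_cb _] := slope_notinK cab aK.
  have := maxab c b _ ab_cb; have := fishburn_inv_notinK wF cab aK; lia.
Qed.

Lemma extremal_adjacent v a b : v \in fishburn K -> extremal v a b ->
  v a = (v b).+1 :> nat.
Proof.
move=> vF [ab vba mab macb mcab].
apply/eqP; rewrite eqn_leq vba andbT leqNgt; apply/negP => gap.
have lt_n : (v b).+1 < n by apply: ltn_trans gap (ltn_ord _).
(* The alternative directly below [b], hence strictly between [b] and [a] in [v]. Each place of [c]
   relative to [a < b] contradicts extremality or the never-condition for [v]. *)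
pose c := (v^-1)%g (Ordinal lt_n).
have vc : v c = (v b).+1 :> nat by rewrite /c permKV.
have ca : c != a :> nat by apply: contraTneq gap => /val_inj <-; lia.
have cb : c != b :> nat by apply/eqP => /val_inj cb; move: vc; rewrite cb; lia.
have [lt_ca|le_ac] := ltnP c a.
  have cab : c < a < b by rewrite lt_ca.
  have [aK|aK] := boolP (a \in K); last by have := mcab c cab aK; lia.
  by have := fishburn_inv_K vF cab aK; lia.
have [lt_cb|le_bc] := ltnP c b; first by have := macb c; lia.
have abc : a < b < c by lia.
have [bK|bK] := boolP (b \in K); first by have := mab c abc bK; lia.
by have := fishburn_inv_notinK vF abc bK; lia.
Qed.

(** The condition on a triple only compares [j] with [i] and [k], so it can break only if [ab] is
    [ij] or [jk]; extremality covers the cases that the swap does not settle by itself. *)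
Lemma extremal_swap v a b : v \in fishburn K -> extremal v a b ->
  (tperm b a * v)%g \in fishburn K.
Proof.
move=> vF exab; have vab := extremal_adjacent vF exab.
case: exab => ab vba mab macb mcab; apply/fishburnP => i j k ijk.
have := fishburnP _ vF i j k ijk.
set u := (tperm b a * v)%g.
have uba : u a < u b by rewrite !swapE tpermL tpermR.
have uE x y : x < y -> (x, y) != (a, b) ->
    (u x < u y) = (v x < v y) /\ (u y < u x) = (v y < v x).
  move=> xy nab; have nba : (x, y) != (b, a) by apply: contraTneq xy => -[-> ->]; lia.
  by split; apply: swap_lt; rewrite // xpair_eqE andbC -xpair_eqE.
have /andP[ij jk] := ijk.
have [[ei ej]|nij] := eqVneq (i, j) (a, b).
  subst i j; case: ifP => bK _; last by rewrite uba.
  have nbk : (b, k) != (a, b) by apply: contraTneq ij => -[-> _]; lia.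
  have [-> _] := uE b k jk nbk; have := mab k ijk bK; lia.
have [[ej ek]|njk] := eqVneq (j, k) (a, b).
  subst j k; case: ifP => aK _; first by rewrite uba orbT.
  have [-> _] := uE i a ij nij; have := mcab i ijk (negbT aK); lia.
by have [-> ->] := uE i j ij nij; have [-> ->] := uE j k jk njk.
Qed.

Lemma fishburn_step v w i j : v \in fishburn K -> w \in fishburn K ->
  i < j -> v j < v i -> w i < w j ->
  exists u, [/\ u \in fishburn K, permutohedron v u &
                #|discordant u w| < #|discordant v w|].
Proof.
move=> vF wF ij vji wij; have [a [b [exab wab]]] := exists_extremal vF wF ij vji wij.
have vab := extremal_adjacent vF exab.
exists (tperm b a * v)%g; split; first exact: extremal_swap.
  by apply/permutohedronP; exists b, a.
exact: card_discordant_swap_lt.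
Qed.

Lemma fishburn_path v w : v \in fishburn K -> w \in fishburn K ->
  exists p, [/\ path (@permutohedron n) v p, last v p = w,
    size p <= #|discordant v w| & {subset v :: p <= fishburn K}].
Proof.
have [m] := ubnP #|discordant v w|; elim: m v w => // m IHm v w.
rewrite ltnS => le_m vF wF.
have [D0|[[i j]]] := set_0Vmem (discordant v w).
  exists [::]; split => //=; first exact: discordant_eq0.
  by move=> x; rewrite inE => /eqP ->.
rewrite inE /= => /andP[vij wji].
have [ij|ji|/val_inj eij] := ltngtP i j; last by rewrite eij ltnn in vij.
- have [u [uF wu]] := fishburn_step wF vF ij wji vij.
  rewrite -!(card_discordantC v) => lt_u.
  have [p [pth lst sz sub]] := IHm v u (leq_trans lt_u le_m) vF uF.
  (* The step leads from [w] towards [v], so it is traversed backwards at the end of the path. *)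
  exists (rcons p w); rewrite rcons_path last_rcons size_rcons lst pth permutohedron_sym wu.
  split=> //; first exact: leq_ltn_trans lt_u.
  by move=> x; rewrite -rcons_cons mem_rcons inE => /orP[/eqP ->|/sub].
- have [u [uF vu lt_u]] := fishburn_step vF wF ji vij wji.
  have [p [pth lst sz sub]] := IHm u w (leq_trans lt_u le_m) uF wF.
  exists (u :: p); rewrite /= vu pth; split=> //; first exact: leq_ltn_trans lt_u.
  by move=> x; rewrite inE => /orP[/eqP ->|/sub].
Qed.

Lemma directly_connected_fishburn : directly_connected (fishburn K).
Proof.
move=> v w vF wF; have [p [pth lst sz sub]] := fishburn_path vF wF.
exists p; split=> //; split=> // q pthq lstq.
exact: leq_trans sz (card_discordant_path pthq lstq).
Qed.

(** In the natural order and its reverse, [j] is ranked between [i] and [k], so it is neither first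
    nor last. *)
Lemma maximal_width_fishburn : maximal_width (fishburn K).
Proof.
exists 1%g, (perm (@rev_ord_inj n)); split.
- by apply/fishburnP => i j k; rewrite !perm1; case: ifP; lia.
- apply/fishburnP => i j k; rewrite !permE /=; have := ltn_ord k.
  by case: ifP; lia.
- move=> a b; rewrite !perm1 !permE /=; have := ltn_ord a; have := ltn_ord b.
  lia.
Qed.

End Fishburn.

Theorem theorem3 (n : nat) (K : {set 'I_n}) (hn : 3 <= n)
  (hK : forall j : 'I_n, j \in K -> 2 <= j.+1 <= n.-1) :
  directly_connected (fishburn K) /\ maximal_width (fishburn K).
Proof. by split; [apply: directly_connected_fishburn | apply: maximal_width_fishburn]. Qed.
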